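(* Let $\mathbb{K}$ be an algebraically closed field of characteristic zero and let $S$ be an affine algebraic monoid over $\mathbb{K}$. Assume that the variety $S$ is isomorphic to an affine space. Then $S$ is (isomorphic to) the multiplicative monoid of a finite dimensional associative $\mathbb{K}$-algebra with unit if and only if the action of the group $G(S)\times G(S)$ on $S$ by left and right multiplication is linearizable.
   Context: An affine algebraic monoid is an irreducible affine variety $S$ with an associative multiplication $S\times S\to S$ that is a morphism of algebraic varieties, and a unit element $e\in S$ with $ea=ae=a$ for all $a\in S$. The group $G(S)$ of invertible elements of $S$ is open in $S$ and is a linear algebraic group. The action of $G(S)\times G(S)$ on $S$ by left and right multiplication is $(g,h)\cdot s=gsh^{-1}$. An action $G\times\mathbb{A}^n\to\mathbb{A}^n$ of a linear algebraic group $G$ is linearizable if the image of $G$ in the automorphism group $\mathrm{Aut}(\mathbb{A}^n)$ of the variety $\mathbb{A}^n$ is conjugate in $\mathrm{Aut}(\mathbb{A}^n)$ to a subgroup of the group $\mathrm{GL}_n(\mathbb{K})$ of all linear transformations of $\mathbb{A}^n$. *)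

(* Defs.v *)
From HB Require Import structures.
From mathcomp Require Import all_boot all_algebra.
From mathcomp.multinomials Require Import mpoly.

Set Implicit Arguments.
Unset Strict Implicit.
Unset Printing Implicit Defensive.

Import GRing.Theory.
Local Open Scope ring_scope.

(* A (possibly reducible) affine variety over K, given by its K-points and a   *)
(* closed embedding into an affine space.  The zero locus of an arbitrary      *)
(* family I of polynomials is allowed, finiteness being automatic (Hilbert).   *)
HB.mixin Record isAffineSet (K : closedFieldType) (X : Type) := {
  embdim : nat;
  coords : X -> 'rV[K]_embdim;
  coords_inj : injective coords;
  coords_closed : exists I : {mpoly K[embdim]} -> Prop, forall v,
    (exists x, coords x = v) <-> (forall p, I p -> p.@[v ord0] = 0)
}.

#[short(type="affineSetType")]
HB.structure Definition AffineSet (K : closedFieldType) :=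
  {X of isAffineSet K X}.

Arguments embdim {K} s.

Definition zariski_closed (K : closedFieldType) (X : affineSetType K)
    (Z : X -> Prop) : Prop :=
  exists I : {mpoly K[embdim X]} -> Prop,
    forall x, Z x <-> (forall p, I p -> p.@[coords x ord0] = 0).

Definition irreducible_set (K : closedFieldType) (X : affineSetType K) : Prop :=
  inhabited X /\
  forall Z1 Z2 : X -> Prop, zariski_closed Z1 -> zariski_closed Z2 ->
    (forall x, Z1 x \/ Z2 x) -> (forall x, Z1 x) \/ (forall x, Z2 x).

(* Morphisms of affine varieties are the maps that are polynomial in the       *)
(* ambient coordinates.                                                        *)
Definition regular (K : closedFieldType) (X Y : affineSetType K) (f : X -> Y) :
    Prop :=
  exists F : 'I_(embdim Y) -> {mpoly K[embdim X]},
    forall x j, coords (f x) ord0 j = (F j).@[coords x ord0].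

Definition biregular (K : closedFieldType) (X Y : affineSetType K)
    (f : X -> Y) (g : Y -> X) : Prop :=
  [/\ regular f, regular g, cancel f g & cancel g f].

Section AffineSpace.
Variables (K : closedFieldType) (n : nat).

Fact affine_space_inj : injective (@id 'rV[K]_n).
Proof. by []. Qed.

Fact affine_space_closed : exists I : {mpoly K[n]} -> Prop, forall v : 'rV[K]_n,
  (exists x, id x = v) <-> (forall p, I p -> p.@[v ord0] = 0).
Proof. by exists (fun=> False) => v; split=> // _; exists v. Qed.

HB.instance Definition _ :=
  isAffineSet.Build K 'rV[K]_n affine_space_inj affine_space_closed.

End AffineSpace.

Section Product.
Variables (K : closedFieldType) (X Y : affineSetType K).

Definition prod_coords (z : X * Y) : 'rV[K]_(embdim X + embdim Y) :=
  row_mx (coords z.1) (coords z.2).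

Fact prod_coords_inj : injective prod_coords.
Proof.
by move=> [x y] [x' y'] /eq_row_mx [/coords_inj /= -> /coords_inj /= ->].
Qed.

Fact prod_coords_closed :
  exists I : {mpoly K[embdim X + embdim Y]} -> Prop, forall v,
    (exists z, prod_coords z = v) <-> (forall p, I p -> p.@[v ord0] = 0).
Proof.
have [IX hX] := coords_closed (s := X); have [IY hY] := coords_closed (s := Y).
pose lX p := p \mPo [tuple 'X_(lshift (embdim Y) i) | i < embdim X] :
  {mpoly K[embdim X + embdim Y]}.
pose lY p := p \mPo [tuple 'X_(rshift (embdim X) i) | i < embdim Y] :
  {mpoly K[embdim X + embdim Y]}.
have lXE p (v : 'rV_(_ + _)) : (lX p).@[v ord0] = p.@[lsubmx v ord0].
  rewrite comp_mpoly_meval; apply: meval_eq => i.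
  by rewrite tnth_mktuple mevalXU mxE.
have lYE p (v : 'rV_(_ + _)) : (lY p).@[v ord0] = p.@[rsubmx v ord0].
  rewrite comp_mpoly_meval; apply: meval_eq => i.
  by rewrite tnth_mktuple mevalXU mxE.
exists (fun q => (exists2 p, IX p & q = lX p) \/ (exists2 p, IY p & q = lY p)).
move=> v; split=> [[[x y] <-] q|hv].
  case=> -[p Ip ->]; rewrite ?lXE ?lYE /prod_coords ?row_mxKl ?row_mxKr.
    by apply: (proj1 (hX _)) Ip; exists x.
  by apply: (proj1 (hY _)) Ip; exists y.
have [|x hx] := proj2 (hX (lsubmx v)).
  by move=> p Ip; rewrite -lXE; apply: hv; left; exists p.
have [|y hy] := proj2 (hY (rsubmx v)).
  by move=> p Ip; rewrite -lYE; apply: hv; right; exists p.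
by exists (x, y); rewrite /prod_coords hx hy hsubmxK.
Qed.

HB.instance Definition _ :=
  isAffineSet.Build K (X * Y)%type prod_coords_inj prod_coords_closed.

End Product.

HB.mixin Record isAffineMonoid (K : closedFieldType) S
    of AffineSet K S & Monoid S := {
  affine_irreducible : irreducible_set S;
  mulg_regular : regular (fun z : S * S => (z.1 * z.2)%g)
}.

#[short(type="affineMonoidType")]
HB.structure Definition AffineMonoid (K : closedFieldType) :=
  {S of AffineSet K S & Monoid S & isAffineMonoid K S}.

(* The pairs (g, g^-1): an invertible element together with its inverse.       *)
Definition invertible_pair (S : monoidType) : pred (S * S) :=
  fun u => (u.1 * u.2 == 1)%g && (u.2 * u.1 == 1)%g.

Record unit_group (S : monoidType) :=
  UnitGroup { unit_pair : S * S; _ : invertible_pair unit_pair }.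

HB.instance Definition _ (S : monoidType) := [isSub for @unit_pair S].
HB.instance Definition _ (S : monoidType) := [Choice of unit_group S by <:].

Definition unit_val (S : monoidType) (g : unit_group S) : S := (unit_pair g).1.

Section UnitGroup.
Variable S : monoidType.
Local Open Scope group_scope.
Implicit Types g h : unit_group S.

Fact unit_one_subproof : invertible_pair (1 : S, 1 : S).
Proof. by rewrite /invertible_pair /= mulg1 eqxx. Qed.

Fact unit_inv_subproof g :
  invertible_pair ((unit_pair g).2, (unit_pair g).1).
Proof. by case: g => u; rewrite /invertible_pair /= andbC. Qed.

Fact unit_mul_subproof g h :
  invertible_pair ((unit_pair g).1 * (unit_pair h).1,
                   (unit_pair h).2 * (unit_pair g).2).
Proof.
have /andP[/eqP ga /eqP gb] : invertible_pair (unit_pair g) by case: g.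
have /andP[/eqP ha /eqP hb] : invertible_pair (unit_pair h) by case: h.
rewrite /invertible_pair /= mulgA -(mulgA _ (unit_pair h).1) ha mulg1 ga.
by rewrite mulgA -(mulgA _ (unit_pair g).2) gb mulg1 hb eqxx.
Qed.

Definition unit_one := UnitGroup unit_one_subproof.
Definition unit_inv g := UnitGroup (unit_inv_subproof g).
Definition unit_mul g h := UnitGroup (unit_mul_subproof g h).

Fact unit_mulA : associative unit_mul.
Proof. by move=> f g h; apply: val_inj; rewrite /= !mulgA. Qed.
Fact unit_1mul : left_id unit_one unit_mul.
Proof. by case=> -[a b] ?; apply: val_inj; rewrite /= mul1g mulg1. Qed.
Fact unit_mul1 : right_id unit_one unit_mul.
Proof. by case=> -[a b] ?; apply: val_inj; rewrite /= mul1g mulg1. Qed.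
Fact unit_mulVg : left_inverse unit_one unit_inv unit_mul.
Proof.
move=> g; have /andP[_ /eqP h] : invertible_pair (unit_pair g) by case: g.
by apply: val_inj; rewrite /= h.
Qed.
Fact unit_mulgV : right_inverse unit_one unit_inv unit_mul.
Proof.
move=> g; have /andP[/eqP h _] : invertible_pair (unit_pair g) by case: g.
by apply: val_inj; rewrite /= h.
Qed.

HB.instance Definition _ := isGroup.Build (unit_group S)
  unit_mulA unit_1mul unit_mul1 unit_mulVg unit_mulgV.

End UnitGroup.

Definition lr_action (S : monoidType) (gh : unit_group S * unit_group S)
    (s : S) : S :=
  (unit_val gh.1 * s * unit_val gh.2^-1)%g.

Definition GL_subgroup (K : closedFieldType) (n : nat) (H : 'M[K]_n -> Prop) :
    Prop :=
  [/\ forall M, H M -> M \in unitmx,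
      H 1%:M,
      forall M N, H M -> H N -> H (M *m N) &
      forall M, H M -> H (invmx M)].

(* Only the image of G in Aut(A^n) matters, so no algebraic structure on the   *)
(* group G is recorded.                                                        *)
Definition linearizable (K : closedFieldType) (n : nat) (G : groupType)
    (act : G -> 'rV[K]_n -> 'rV[K]_n) : Prop :=
  exists psi psi' : 'rV[K]_n -> 'rV[K]_n, biregular psi psi' /\
  exists2 H : 'M[K]_n -> Prop, GL_subgroup H &
    forall f : 'rV[K]_n -> 'rV[K]_n,
      (exists g : G, f =1 psi \o act g \o psi') <->
      (exists2 M, H M & f =1 mulmxr M).

(* Finite-dimensional associative unital algebras.  MathComp's falgType        *)
(* requires 1 <> 0 and so excludes the zero algebra, whose multiplicative      *)
(* monoid is the one-point monoid on A^0.                                      *)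
Record finDimAlgebra (K : fieldType) := FinDimAlgebra {
  alg_space :> vectType K;
  alg_mul : alg_space -> alg_space -> alg_space;
  alg_one : alg_space;
  alg_mulA : associative alg_mul;
  alg_1mul : left_id alg_one alg_mul;
  alg_mul1 : right_id alg_one alg_mul;
  alg_linear_l : forall y, linear (fun x => alg_mul x y);
  alg_linear_r : forall x, linear (alg_mul x)
}.

(* The variety underlying a finite-dimensional vector space: v2r is the linear *)
(* coordinate isomorphism provided by vectType; another choice of basis would  *)
(* give the same regular maps.  The alias keeps this structure apart from      *)
(* those of concrete vector spaces such as 'rV[K]_n.                           *)
Definition vect_variety (K : closedFieldType) (V : vectType K) : Type := V.

Section VectorVariety.
Variables (K : closedFieldType) (V : vectType K).

Fact vect_coords_inj : injective
  (VectorInternalTheory.v2r : vect_variety V -> 'rV[K]_(dim V)).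
Proof. exact: VectorInternalTheory.v2r_inj. Qed.

Fact vect_coords_closed : exists I : {mpoly K[dim V]} -> Prop, forall v,
  (exists x : vect_variety V, VectorInternalTheory.v2r x = v) <->
  (forall p, I p -> p.@[v ord0] = 0).
Proof.
exists (fun=> False) => v; split=> // _.
by exists (VectorInternalTheory.r2v v); rewrite VectorInternalTheory.r2vK.
Qed.

HB.instance Definition _ :=
  isAffineSet.Build K (vect_variety V) vect_coords_inj vect_coords_closed.

End VectorVariety.

Definition isomorphic_to_mult_monoid (K : closedFieldType)
    (S : affineMonoidType K) (A : finDimAlgebra K) : Prop :=
  exists (f : S -> vect_variety A) (g : vect_variety A -> S),
    [/\ biregular f g, f 1%g = alg_one A &
        forall x y, f (x * y)%g = alg_mul (f x) (f y)].

(* Main.v *)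
From HB Require Import structures.
Require Import Defs.
From mathcomp Require Import all_boot all_algebra.
From mathcomp.multinomials Require Import mpoly.
From Stdlib Require Import Classical.

(* If the action is linearizable, transport the monoid to V = K^n so that the  *)
(* units act linearly on both sides.  The units are Zariski dense in V, and    *)
(* linearity of a translation is a closed condition on the translating         *)
(* element, so the product is bilinear and V is an algebra.                    *)
(* Density: the coordinate functions of the left translations span a           *)
(* finite-dimensional space on which s acts by a matrix A(s) with A(e) = 1;    *)
(* where det A(s) <> 0, the translation by s has a polynomial left inverse.    *)
(* In characteristic zero this is a two-sided inverse: the Jacobian matrix is  *)
(* invertible everywhere, so a polynomial vanishing on the image has all its   *)
(* derivatives vanishing on the image, and is 0 by induction on the degree.    *)
(* Conversely, the units of an algebra act linearly, and dim A = n because the *)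
(* Jacobian matrices of inverse polynomial maps are inverse to each other.     *)

Set Implicit Arguments.
Unset Strict Implicit.
Unset Printing Implicit Defensive.

Import GRing.Theory VectorInternalTheory.
Local Open Scope ring_scope.

(** From linearizability to an algebra: for fixed arguments, the failure of a translation to be
    linear is a regular function of the translating element. It vanishes on units, hence everywhere
    by [units_dense], which gives [units_linear_l] and [units_linear_r]. Density combines three
    facts. By [generic_left_inverse], translations by elements of a principal open set around [e]
    have polynomial left inverses. By [regular_left_inverse], where characteristic zero enters,
    these are two-sided. By [meval_dense], a nonempty principal open set is dense. From an algebra
    to linearizability: bilinearity makes the action linear in a basis, and [biregular_dim] matches
    the dimensions. *)

Lemma poly_fun_eq0 (K : closedFieldType) (p : {poly K}) :
  (forall t, p.[t] = 0) -> p = 0.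
Proof.
move=> p0; apply/eqP/negPn/negP => /closed_nonrootP[t].
by rewrite /root p0 eqxx.
Qed.

Lemma mnm_subUU n (i : 'I_n) : (U_(i) - U_(i) = 0)%MM.
Proof. by apply/mnmP => j; rewrite !mnmE subnn. Qed.

(** * Polynomials restricted to curves and lines *)

Section Curves.
Variables (K : closedFieldType) (n : nat).
Implicit Types (p q : {mpoly K[n]}) (u : 'I_n -> {poly K}) (x y v : 'rV[K]_n).

Definition along u p : {poly K} := mmap polyC u p.

Lemma horner_along u p t : (along u p).[t] = p.@[fun i => (u i).[t]].
Proof.
rewrite /along mevalE /mmap horner_sum; apply: eq_bigr => m _.
rewrite hornerCM /mmap1 horner_prod; congr (_ * _).
by apply: eq_bigr => i _; rewrite horner_exp.
Qed.

Lemma along1 u : along u 1 = 1.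
Proof. by rewrite /along -[1]/(1%:MP_[n]) mmapC. Qed.

Lemma alongM u : {morph along u : p q / p * q}.
Proof. by move=> p q; apply: (mmap_is_multiplicative u polyC).1. Qed.

(** Both sides satisfy the same Leibniz rule in [p], so constants and variables suffice. *)
Lemma along_chain u p :
  (along u p)^`() = \sum_i along u p^`M(i) * (u i)^`().
Proof.
pose P p := (along u p)^`() = \sum_i along u p^`M(i) * (u i)^`().
have P1 : P 1.
  rewrite /P along1 -[1 in LHS]/(1%:P) derivC big1 // => i _.
  by rewrite -[1]/(1%:MP_[n]) mderivC /along mmap0 mul0r.
have PM q r : P q -> P r -> P (q * r).
  rewrite /P alongM derivM => -> ->; rewrite mulr_suml mulr_sumr -big_split.
  apply: eq_bigr => i _ /=.
  by rewrite mderivM /along mmapD -!/(along _ _) !alongM mulrDl mulrAC !mulrA.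
have PX i : P 'X_i.
  rewrite /P (bigD1 i) //= big1 => [|j ji]; rewrite mderivX mnm1E.
    rewrite eqxx mnm_subUU scale1r mpolyX0 along1 mul1r addr0.
    by rewrite /along mmapX mmap1U.
  by rewrite eq_sym (negPf ji) scale0r /along mmap0 mul0r.
elim/mpolyind: p => [|c m p _ _ IHp]; rewrite -/(P _).
  rewrite /P /along mmap0 deriv0 big1 // => i _.
  by rewrite mderiv0 mmap0 mul0r.
have Pm : P 'X_[m].
  rewrite mpolyXE_id; apply: (big_ind P) => // i _.
  by elim: (m i) => // k IHk; rewrite exprS; apply: PM.
rewrite /P /along mmapD mmapZ derivD deriv_mulC -!/(along _ _) Pm IHp.
rewrite mulr_sumr -big_split; apply: eq_bigr => i _ /=.
by rewrite mderivD mderivZ /along mmapD mmapZ mulrDl mulrA.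
Qed.

Definition on_line x v p : {poly K} :=
  along (fun i => (x 0 i)%:P + v 0 i *: 'X) p.

Lemma horner_on_line x v p t : (on_line x v p).[t] = p.@[(x + t *: v) 0].
Proof.
rewrite horner_along; apply: meval_eq => i.
by rewrite !hornerE !mxE mulrC.
Qed.

Lemma deriv_on_line x v p :
  (on_line x v p)^`() = \sum_i v 0 i *: on_line x v p^`M(i).
Proof.
rewrite along_chain; apply: eq_bigr => i _.
by rewrite derivD derivC derivZ derivX add0r -scalerAr mulr1.
Qed.

Lemma deriv_on_line0 x v p :
  (on_line x v p)^`().[0] = \sum_i v 0 i * p^`M(i).@[x 0].
Proof.
rewrite deriv_on_line horner_sum; apply: eq_bigr => i _.
by rewrite hornerZ horner_on_line scale0r addr0.
Qed.

(** On the line from [x0] to [x], the product [P * D] vanishes identically while [D] is nonzero at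
    [t = 0]; [{poly K}] is a domain. *)
Lemma meval_dense (p d : {mpoly K[n]}) x0 : d.@[x0 0] != 0 ->
  (forall x, d.@[x 0] != 0 -> p.@[x 0] = 0) -> forall x, p.@[x 0] = 0.
Proof.
move=> d0 pd x; pose P := on_line x0 (x - x0) p; pose D := on_line x0 (x - x0) d.
suff P0 : P = 0.
  have /eqP := horner_on_line x0 (x - x0) p 1.
  by rewrite -/P P0 horner0 scale1r addrC subrK eq_sym => /eqP.
have /eqP : P * D = 0.
  apply: poly_fun_eq0 => t; rewrite hornerM !horner_on_line.
  have [->|/pd->] := eqVneq d.@[(x0 + t *: (x - x0)) 0] 0; first exact: mulr0.
  exact: mul0r.
rewrite mulf_eq0 => /orP[/eqP // | /eqP D0].
move: d0; have := horner_on_line x0 (x - x0) d 0.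
by rewrite -/D D0 horner0 scale0r addr0 => <-; rewrite eqxx.
Qed.

Lemma deriv_eq0 (P : {poly K}) : [pchar K] =i pred0 ->
  P^`() = 0 -> P = (P`_0)%:P.
Proof.
move=> /pcharf0P K0 P0; apply/polyP => -[|i]; rewrite coefC //=.
have /eqP := congr1 (fun Q : {poly K} => Q`_i) P0.
by rewrite coef_deriv coef0 -mulr_natr mulf_eq0 K0 orbF => /eqP.
Qed.

Lemma mderiv_eq0_const p : [pchar K] =i pred0 ->
  (forall i x, p^`M(i).@[x 0] = 0) -> forall x y, p.@[x 0] = p.@[y 0].
Proof.
move=> K0 p0 x y.
have P0 : (on_line x (y - x) p)^`() = 0.
  apply: poly_fun_eq0 => t; rewrite deriv_on_line horner_sum big1 // => i _.
  by rewrite hornerZ horner_on_line p0 mulr0.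
have := horner_on_line x (y - x) p 1; have := horner_on_line x (y - x) p 0.
rewrite (deriv_eq0 K0 P0) !hornerC scale0r addr0 => -> ->.
by rewrite scale1r addrC subrK.
Qed.

Lemma msize_mderiv i p : (msize p^`M(i) <= (msize p).-1)%N.
Proof.
rewrite mmeasureE; apply/bigmax_leqP_seq => m + _.
rewrite mcoeff_msupp mcoeff_deriv => pm.
have : (m + U_(i))%MM \in msupp p.
  by rewrite mcoeff_msupp; apply: contraNneq pm => ->; rewrite mul0rn.
move/msize_mdeg_lt; rewrite mdegD mdeg1 addn1.
by case: (msize p).
Qed.

End Curves.

(** * Closure properties of regular functions and maps *)

Section Regular.
Variable K : closedFieldType.
Implicit Types X Y Z : affineSetType K.

Definition regular_fun X (f : X -> K) :=
  exists p : {mpoly K[embdim X]}, forall x, f x = p.@[coords x 0].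

Lemma regularP X Y (f : X -> Y) :
  regular f <-> forall j, regular_fun (fun x => coords (f x) 0 j).
Proof.
split=> [[F hF] j|hf]; first by exists (F j) => x; apply: hF.
have [F hF] := fin_all_exists hf.
by exists F => x j; apply: hF.
Qed.

Lemma regular_fun_ext X (f g : X -> K) :
  f =1 g -> regular_fun f -> regular_fun g.
Proof. by move=> fg [p hp]; exists p => x; rewrite -fg. Qed.

Lemma regular_cst X (c : K) : regular_fun (fun _ : X => c).
Proof. by exists c%:MP => x; rewrite mevalC. Qed.

Lemma regular_coord X j : regular_fun (fun x : X => coords x 0 j).
Proof. by exists 'X_j => x; rewrite mevalXU. Qed.

Lemma regularD X (f g : X -> K) :
  regular_fun f -> regular_fun g -> regular_fun (fun x => f x + g x).
Proof. by move=> [p hp] [q hq]; exists (p + q) => x; rewrite mevalD hp hq. Qed.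

Lemma regularM X (f g : X -> K) :
  regular_fun f -> regular_fun g -> regular_fun (fun x => f x * g x).
Proof. by move=> [p hp] [q hq]; exists (p * q) => x; rewrite mevalM hp hq. Qed.

Lemma regular_sum X (I : Type) (r : seq I) (P : pred I) (f : I -> X -> K) :
  (forall i, regular_fun (f i)) ->
  regular_fun (fun x => \sum_(i <- r | P i) f i x).
Proof.
move=> hf; elim: r => [|i r IHr].
  by apply: regular_fun_ext (regular_cst X 0) => x; rewrite big_nil.
have [Pi|nPi] := boolP (P i).
  apply: regular_fun_ext (regularD (hf i) IHr) => x.
  by rewrite big_cons Pi.
by apply: regular_fun_ext IHr => x; rewrite big_cons (negPf nPi).
Qed.

Lemma regular_prod X (I : Type) (r : seq I) (P : pred I) (f : I -> X -> K) :
  (forall i, regular_fun (f i)) ->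
  regular_fun (fun x => \prod_(i <- r | P i) f i x).
Proof.
move=> hf; elim: r => [|i r IHr].
  by apply: regular_fun_ext (regular_cst X 1) => x; rewrite big_nil.
have [Pi|nPi] := boolP (P i).
  apply: regular_fun_ext (regularM (hf i) IHr) => x.
  by rewrite big_cons Pi.
by apply: regular_fun_ext IHr => x; rewrite big_cons (negPf nPi).
Qed.

Lemma regular_mulmx X m n p (A : X -> 'M[K]_(m, n)) (B : X -> 'M[K]_(n, p)) :
  (forall i j, regular_fun (fun x => A x i j)) ->
  (forall i j, regular_fun (fun x => B x i j)) ->
  forall i j, regular_fun (fun x => (A x *m B x) i j).
Proof.
move=> hA hB i j; pose f x := \sum_k A x i k * B x k j.
apply: (@regular_fun_ext _ f) => [x|]; first by rewrite mxE.
by apply: regular_sum => k; apply: regularM.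
Qed.

Lemma regular_det X n (A : X -> 'M[K]_n) :
  (forall i j, regular_fun (fun x => A x i j)) ->
  regular_fun (fun x => \det (A x)).
Proof.
move=> hA; apply: regular_sum => s; apply: regularM; first exact: regular_cst.
exact: regular_prod.
Qed.

Lemma regular_fun_comp X Y (f : X -> Y) (g : Y -> K) :
  regular f -> regular_fun g -> regular_fun (fun x => g (f x)).
Proof.
move=> [F hF] [p hp]; exists (p \mPo [tuple F i | i < embdim Y]) => x.
rewrite comp_mpoly_meval hp; apply: meval_eq => i.
by rewrite tnth_mktuple -hF.
Qed.

Lemma regular_comp X Y Z (f : X -> Y) (g : Y -> Z) :
  regular f -> regular g -> regular (g \o f).
Proof.
move=> hf /regularP hg; apply/regularP => j.
exact: regular_fun_comp hf (hg j).
Qed.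

Lemma regular_id X : regular (@id X).
Proof. by apply/regularP => j; apply: regular_coord. Qed.

Lemma regular_const X Y (y : Y) : regular (fun _ : X => y).
Proof. by apply/regularP => j; apply: regular_cst. Qed.

Lemma regular_pair X Y Z (f : X -> Y) (g : X -> Z) :
  regular f -> regular g -> regular (fun x => (f x, g x)).
Proof.
move=> /regularP hf /regularP hg; apply/regularP => j.
rewrite -(splitK j); case: (split j) => i.
  by apply: regular_fun_ext (hf i) => x; rewrite [coords _]/= row_mxEl.
by apply: regular_fun_ext (hg i) => x; rewrite [coords _]/= row_mxEr.
Qed.

Lemma regular_fst X Y : regular (@fst X Y).
Proof.
apply/regularP => j; have h := @regular_coord (X * Y)%type (lshift _ j).
by apply: regular_fun_ext h => x; rewrite [coords _]/= row_mxEl.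
Qed.

Lemma regular_snd X Y : regular (@snd X Y).
Proof.
apply/regularP => j; have h := @regular_coord (X * Y)%type (rshift _ j).
by apply: regular_fun_ext h => x; rewrite [coords _]/= row_mxEr.
Qed.

Lemma regular_linear m n (f : 'rV[K]_m -> 'rV[K]_n) :
  linear f -> regular f.
Proof.
move=> lf; pose fL := GRing.isLinear.Build K _ _ _ f lf.
pose g : {linear 'rV[K]_m -> 'rV[K]_n} := HB.pack f fL.
apply/regularP => j.
pose h (x : 'rV[K]_m) := (x *m lin1_mx g) 0 j.
apply: (@regular_fun_ext _ h) => [x|]; first by rewrite /h mul_rV_lin1.
apply: regular_mulmx => [i k|i k]; last exact: regular_cst.
by rewrite ord1; apply: regular_coord.
Qed.

End Regular.

(** * Jacobian matrices and polynomial left inverses *)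

Section Jacobian.
Variable K : closedFieldType.

Lemma jacobian_chain m n (F : 'I_n -> {mpoly K[m]}) (f : 'rV[K]_m -> 'rV[K]_n)
    (p : {mpoly K[n]}) (q : {mpoly K[m]}) :
  (forall x j, f x 0 j = (F j).@[x 0]) ->
  (forall x, p.@[f x 0] = q.@[x 0]) ->
  forall i x, \sum_k p^`M(k).@[f x 0] * (F k)^`M(i).@[x 0] = q^`M(i).@[x 0].
Proof.
move=> fF pq i x; pose v : 'rV[K]_m := delta_mx 0 i.
have onlineE r : (on_line x v r)^`().[0] = r^`M(i).@[x 0].
  rewrite deriv_on_line0 (bigD1 i) //= big1 => [|j ji]; rewrite mxE eqxx /=.
    by rewrite eqxx mul1r addr0.
  by rewrite (negPf ji) mul0r.
pose P := along (fun k => on_line x v (F k)) p.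
have eval t r : r.@[fun k => (on_line x v (F k)).[t]] = r.@[f (x + t *: v) 0].
  by apply: meval_eq => k; rewrite horner_on_line fF.
(* [pq] only equates values; over an infinite field this gives equal polynomials in [t], which can
   be differentiated. *)
have PE : P = on_line x v q.
  apply/eqP; rewrite -subr_eq0; apply/eqP/poly_fun_eq0 => t.
  by rewrite hornerD hornerN horner_along eval pq horner_on_line subrr.
rewrite -onlineE -PE along_chain horner_sum; apply: eq_bigr => k _.
by rewrite hornerM onlineE horner_along eval scale0r addr0.
Qed.

Lemma regular_rV m n (f : 'rV[K]_m -> 'rV[K]_n) : regular f ->
  exists F : 'I_n -> {mpoly K[m]}, forall x j, f x 0 j = (F j).@[x 0].
Proof. by case=> F hF; exists F. Qed.

Definition jacobian m n (F : 'I_n -> {mpoly K[m]}) (x : 'rV[K]_m) :=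
  \matrix_(j < n, i < m) (F j)^`M(i).@[x 0].

Lemma jacobian_cancel m n (F : 'I_n -> {mpoly K[m]}) (G : 'I_m -> {mpoly K[n]})
    (f : 'rV[K]_m -> 'rV[K]_n) (g : 'rV[K]_n -> 'rV[K]_m) :
  (forall x j, f x 0 j = (F j).@[x 0]) ->
  (forall x j, g x 0 j = (G j).@[x 0]) ->
  cancel f g -> forall x, jacobian G (f x) *m jacobian F x = 1%:M.
Proof.
move=> fF gG fK x; apply/matrixP => j i; rewrite !mxE.
transitivity (('X_j : {mpoly K[m]})^`M(i).@[x 0]).
  rewrite -(jacobian_chain fF (p := G j)) => [|y]; last first.
    by rewrite mevalXU -gG fK.
  by apply: eq_bigr => k _; rewrite !mxE.
rewrite mderivX mnm1E mevalZ; have [->|ji] := eqVneq j i.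
  by rewrite mnm_subUU mpolyX0 meval1 mulr1.
by rewrite mul0r.
Qed.

Lemma biregular_dim m n (f : 'rV[K]_m -> 'rV[K]_n) (g : 'rV[K]_n -> 'rV[K]_m) :
  biregular f g -> m = n.
Proof.
case=> /regular_rV[F fF] /regular_rV[G gG] fK gK.
have rank_le k l (A : 'M[K]_(k, l)) (B : 'M_(l, k)) :
    A *m B = 1%:M -> (k <= l)%N.
  by move=> AB; rewrite -(mxrank1 K k) -AB mulmx_max_rank.
have /rank_le mn := jacobian_cancel fF gG fK 0.
have /rank_le nm := jacobian_cancel gG fF gK 0.
by apply/eqP; rewrite eqn_leq mn.
Qed.

Lemma regular_left_inverse n (f g : 'rV[K]_n -> 'rV[K]_n) :
  [pchar K] =i pred0 -> regular f -> regular g -> cancel f g -> cancel g f.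
Proof.
move=> K0 /regular_rV[F fF] /regular_rV[G gG] fK.
have Junit x : jacobian F x \in unitmx.
  by have /mulmx1_unit[] := jacobian_cancel fF gG fK x.
(* Differentiating [p] composed with [f] kills the gradient of [p] on the image, since the Jacobian
   is invertible. By induction on the degree the partials vanish everywhere, so [p] is constant,
   equal to its value 0 at [f 0]. *)
have dominant p : (forall x, p.@[f x 0] = 0) -> forall y : 'rV_n, p.@[y 0] = 0.
  elim: {p}(msize p) {-2}p (leqnn (msize p)) => [|k IHk] p.
    by rewrite leqn0 msize_poly_eq0 => /eqP-> _ y; rewrite meval0.
  move=> pk pf y; rewrite (mderiv_eq0_const K0 _ y (f 0)) // => {y} i y.
  apply: IHk y => [|x].
    by rewrite (leq_trans (msize_mderiv i p)) // -subn1 leq_subLR add1n.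
  pose D := \row_i p^`M(i).@[f x 0].
  have /(canRL (mulmxK (Junit x))) : D *m jacobian F x = 0.
    apply/rowP => j; rewrite !mxE.
    have pf0 z : p.@[f z 0] = (0 : {mpoly K[n]}).@[z 0] by rewrite pf meval0.
    rewrite -[RHS](meval0 (x 0)) -(mderiv0 K j) -(jacobian_chain fF pf0).
    by apply: eq_bigr => l _; rewrite !mxE.
  by rewrite mul0mx => /rowP/(_ i); rewrite !mxE.
move=> y; apply/rowP => j; apply/eqP; rewrite -subr_eq0; apply/eqP.
(* A coordinate of [f (g z) - z], which vanishes on the image of [f]. *)
pose p : {mpoly K[n]} := (F j \mPo [tuple G i | i < n]) - 'X_j.
have pE (z : 'rV_n) : p.@[z 0] = f (g z) 0 j - z 0 j.
  rewrite mevalB mevalXU comp_mpoly_meval fF; congr (_ - _).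
  by apply: meval_eq => i; rewrite tnth_mktuple gG.
by rewrite -pE; apply: dominant => x; rewrite pE fK subrr.
Qed.

End Jacobian.

(** * Kernels of finite rank and interpolation *)

Section FiniteRankKernels.
Variables (K : fieldType) (I X : Type).
Implicit Type k : I -> X -> K.

(** Equivalently, the functions [k i] lie in the span of finitely many functions on [X]. *)
Definition finite_rank k :=
  exists N (u : I -> 'rV[K]_N) (v : X -> 'cV[K]_N),
    forall i x, k i x = (u i *m v x) 0 0.

Lemma finite_rank_ext k1 k2 : k1 =2 k2 -> finite_rank k1 -> finite_rank k2.
Proof. by move=> e [N [u [v h]]]; exists N, u, v => i x; rewrite -e. Qed.

Lemma finite_rankD k1 k2 : finite_rank k1 -> finite_rank k2 ->
  finite_rank (fun i x => k1 i x + k2 i x).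
Proof.
move=> [N1 [u1 [v1 h1]]] [N2 [u2 [v2 h2]]]; exists (N1 + N2)%N.
exists (fun i => row_mx (u1 i) (u2 i)), (fun x => col_mx (v1 x) (v2 x)).
by move=> i x; rewrite mul_row_col mxE h1 h2.
Qed.

Lemma finite_rank_prod (f : I -> K) (g : X -> K) :
  finite_rank (fun i x => f i * g x).
Proof.
exists 1%N, (fun i => (f i)%:M), (fun x => (g x)%:M) => i x.
by rewrite -scalar_mxM mxE eqxx.
Qed.

Lemma finite_rank_sum (T : Type) (r : seq T) (k : T -> I -> X -> K) :
  (forall t, finite_rank (k t)) ->
  finite_rank (fun i x => \sum_(t <- r) k t i x).
Proof.
move=> hk; elim: r => [|t r IHr].
  by exists 0%N, (fun=> 0), (fun=> 0) => i x; rewrite big_nil mul0mx mxE.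
apply: finite_rank_ext (finite_rankD (hk t) IHr) => i x.
by rewrite big_cons.
Qed.

(* A maximal invertible matrix of values [k (i a) (x b)]: all the bordered     *)
(* determinants vanish, which is the interpolation formula.                    *)
Lemma finite_rank_interpolation k : finite_rank k ->
  exists r (i : 'I_r -> I) (x : 'I_r -> X),
    let B := \matrix_(a, b) k (i a) (x b) in
    B \in unitmx /\ forall j y,
      k j y = (\row_b k j (x b) *m invmx B *m \col_a k (i a) y) 0 0.
Proof.
case=> N [u [v kE]].
have bound r (i : 'I_r -> I) (x : 'I_r -> X) :
    \matrix_(a, b) k (i a) (x b) \in unitmx -> (r <= N)%N.
  set B := \matrix_(a, b) _ => /mxrank_unit <-.
  have -> : B = \matrix_a u (i a) *m \matrix_(l, b) v (x b) l 0.
    apply/matrixP => a b; rewrite !mxE kE mxE.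
    by apply: eq_bigr => l _; rewrite !mxE.
  exact: mulmx_max_rank.
(* [m] is fuel: each bordering raises [r], and [bound] forbids [r > N]. *)
suff extend m r (i : 'I_r -> I) (x : 'I_r -> X) : (N < r + m)%N ->
    \matrix_(a, b) k (i a) (x b) \in unitmx ->
    exists r (i : 'I_r -> I) (x : 'I_r -> X),
      let B := \matrix_(a, b) k (i a) (x b) in
      B \in unitmx /\ forall j y,
        k j y = (\row_b k j (x b) *m invmx B *m \col_a k (i a) y) 0 0.
  have no (Y : Type) (a : 'I_0) : Y by case: a.
  apply: (extend N.+1 0%N (no I) (no X)) => //.
  by rewrite unitmxE det_mx00 unitr1.
elim: m r i x => [|m IHm] r i x Nr Bu.
  by have := leq_trans Nr (leq_trans (eq_leq (addn0 r)) (bound _ _ _ Bu));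
    rewrite ltnn.
pose B := \matrix_(a, b) k (i a) (x b).
pose row j := \row_b k j (x b); pose col y := \col_a k (i a) y.
have [h|/not_all_ex_not[j /not_all_ex_not[y jy]]] :=
  classic (forall j y, k j y = (row j *m invmx B *m col y) 0 0).
  by exists r, i, x.
pose i' (a : 'I_(r + 1)) := if split a is inl a' then i a' else j.
pose x' (a : 'I_(r + 1)) := if split a is inl a' then x a' else y.
apply: (IHm _ i' x'); first by rewrite addn1 addSnnS.
have -> : \matrix_(a, b) k (i' a) (x' b)
        = block_mx B (col y) (row j) (k j y)%:M.
  apply/matrixP => a b; rewrite -(splitK a) -(splitK b).
  case: (split a) => a'; case: (split b) => b'; rewrite mxE /i' /x' !unsplitK.
  - by rewrite block_mxEul mxE.
  - by rewrite block_mxEur mxE.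
  - by rewrite block_mxEdl mxE.
  - by rewrite block_mxEdr !ord1 mxE eqxx.
have Bu' : B \in unitmx by [].
(* The Schur complement of [B]: it is the interpolation defect at [(j, y)], and elimination by [L]
   makes the bordered determinant [\det B] times it. *)
pose S := (k j y)%:M - row j *m invmx B *m col y.
pose L : 'M[K]_(r + 1) := block_mx 1%:M 0 (- (row j *m invmx B)) 1%:M.
have : \det (L *m block_mx B (col y) (row j) (k j y)%:M) = \det B * \det S.
  rewrite mulmx_block !mul1mx !mul0mx !addr0 !mulNmx mulmxKV // addNr.
  by rewrite [- _ + _]addrC det_ublock.
rewrite det_mulmx det_lblock !det1 !mul1r unitmxE => ->.
rewrite unitrM -unitmxE Bu' det_mx11 unitfE.
have -> : S 0 0 = k j y - (row j *m invmx B *m col y) 0 0.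
  by rewrite mxE [X in X + _]mxE [X in _ + X]mxE eqxx.
by rewrite subr_eq0; apply/eqP.
Qed.

End FiniteRankKernels.

(** * Density of units and bilinearity of the product *)

Section MonoidOnAffineSpace.
Variables (K : closedFieldType) (n : nat).
Variables (m : 'rV[K]_n -> 'rV[K]_n -> 'rV[K]_n) (e : 'rV[K]_n).
Hypothesis K0 : [pchar K] =i pred0.
Hypothesis m_reg : regular (fun z : 'rV[K]_n * 'rV[K]_n => m z.1 z.2).
Hypotheses (mA : associative m) (m1x : left_id e m) (mx1 : right_id e m).

Lemma mul_regular_l x : regular (fun s => m s x).
Proof.
have h := regular_pair (@regular_id _ 'rV[K]_n) (regular_const 'rV[K]_n x).
exact: regular_comp h m_reg.
Qed.

Lemma mul_regular_r s : regular (m s).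
Proof.
have h := regular_pair (regular_const 'rV[K]_n s) (@regular_id _ 'rV[K]_n).
exact: regular_comp h m_reg.
Qed.

(** With the translating element in the index, associativity turns translation of the argument into
    a change of index, so the span of these functions is stable. *)
Let coefs (js : 'I_n * 'rV[K]_n) (x : 'rV[K]_n) := m js.2 x 0 js.1.

(** Each monomial of the product splits into a monomial in [s] times one in [x]; the Kronecker
    factor selects the coordinate. *)
Lemma mul_finite_rank : finite_rank coefs.
Proof.
have [F hF] := m_reg.
pose k j mon (js : 'I_n * 'rV[K]_n) (x : 'rV[K]_n) : K :=
  ((j == js.1)%:R * ((F j)@_mon * \prod_i js.2 0 i ^+ mon (lshift n i))) *
  \prod_i x 0 i ^+ mon (rshift n i).
have hk : finite_rank (fun js x => \sum_(j <- enum 'I_n) \sum_(mon <- msupp (F j))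
    k j mon js x).
  by do 2!apply: finite_rank_sum => ?; apply: finite_rank_prod.
apply: finite_rank_ext hk => -[j s] x; rewrite big_enum /= (bigD1 j) //=.
rewrite [X in _ + X]big1 => [|i ij]; last first.
  by apply: big1_seq => mon _; rewrite /k /= (negPf ij) !mul0r.
rewrite addr0 /coefs /= [RHS](hF (s, x) j) mevalE; apply: eq_bigr => mon _.
rewrite /k eqxx mul1r -mulrA /=; congr (_ * _).
rewrite big_split_ord /=; congr (_ * _); apply: eq_bigr => i _.
  by rewrite row_mxEl.
by rewrite row_mxEr.
Qed.

(* On the finite-dimensional space spanned by the coordinates of the maps      *)
(* [m s], with basis [b], translation by [s] is a matrix [A s].  The           *)
(* coordinates lie in that space, so where [A s] is invertible they are        *)
(* polynomials in [m s y].                                                     *)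
Lemma generic_left_inverse :
  exists d : {mpoly K[n]}, d.@[e 0] != 0 /\
    forall s : 'rV_n, d.@[s 0] != 0 ->
      exists2 w : 'rV[K]_n -> 'rV[K]_n, regular w & cancel (m s) w.
Proof.
have [r [i [x]]] := finite_rank_interpolation mul_finite_rank.
set B := \matrix_(a, b) _ => -[Bu interp].
pose b y := \col_a coefs (i a) y.
pose A s := \matrix_(a, c) coefs (i a) (m s (x c)) *m invmx B.
have coefsM js s y : coefs js (m s y) = coefs (js.1, m js.2 s) y.
  by rewrite /coefs /= mA.
have bM s y : b (m s y) = A s *m b y.
  apply/colP => a; rewrite mxE coefsM interp !mxE; apply: eq_bigr => c _.
  congr (_ * _); rewrite !mxE; apply: eq_bigr => c' _.
  by rewrite !mxE coefsM.
(* As [e] is a left unit, coordinate [j] is [coefs (j, e)], to which interpolation applies. *)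
pose Q : 'M[K]_(n, r) := \matrix_(j, c) x c 0 j *m invmx B.
have yE y : y^T = Q *m b y.
  apply/colP => j; rewrite mxE -[in LHS](m1x y) -[LHS]/(coefs (j, e) y) interp.
  rewrite !mxE; apply: eq_bigr => c _; congr (_ * _).
  by rewrite !mxE; apply: eq_bigr => c' _; rewrite !mxE /coefs /= m1x.
have coefs_reg js : regular_fun (coefs js).
  have /regularP/(_ js.1) := mul_regular_r js.2; exact.
have A_reg a c : regular_fun (fun s : 'rV[K]_n => A s a c).
  apply: regular_mulmx => [a' c'|a' c']; last exact: regular_cst.
  have h := regular_fun_comp (mul_regular_l (x c')) (coefs_reg (i a')).
  by apply: regular_fun_ext h => s; rewrite mxE.
have [d dE] := regular_det A_reg.
exists d; split=> [|s].
  rewrite -[d.@[_]](dE e); suff -> : A e = 1%:M by rewrite det1 oner_eq0.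
  rewrite /A -(mulmxV Bu); congr (_ *m _).
  by apply/matrixP => a c; rewrite !mxE m1x.
rewrite -[d.@[_]](dE s) -unitfE -unitmxE => Au.
exists (fun y => (Q *m invmx (A s) *m b y)^T) => [|y]; last first.
  by rewrite bM mulmxA mulmxKV // -yE trmxK.
apply/regularP => j.
pose f (y : 'rV[K]_n) := (Q *m invmx (A s) *m b y) j 0.
apply: (@regular_fun_ext _ _ f) => [y|]; first by rewrite [RHS]mxE.
apply: regular_mulmx => [a c|a c]; first exact: regular_cst.
by apply: regular_fun_ext (coefs_reg (i a)) => y; rewrite mxE.
Qed.

Definition unit_in (s : 'rV[K]_n) := exists t, m s t = e /\ m t s = e.

(** Where [d] is nonzero, [m s] is bijective with inverse [w], so [w e] is a right inverse of [s];
    injectivity of [m s] makes it a left inverse too. *)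
Lemma units_dense (f : 'rV[K]_n -> K) :
  regular_fun f -> (forall s, unit_in s -> f s = 0) -> forall s, f s = 0.
Proof.
case=> p pE fu; have [d [de inv]] := generic_left_inverse.
suff p0 (s : 'rV[K]_n) : p.@[s 0] = 0 by move=> s; rewrite pE; apply: p0.
apply: (meval_dense de) => {}s /inv[w wreg wK].
rewrite -[LHS](pE s) fu //; exists (w e).
have /(_ e) ms := regular_left_inverse K0 (mul_regular_r s) wreg wK.
split=> //; apply: (can_inj wK).
by rewrite mA ms m1x mx1.
Qed.

Lemma units_linear_l :
  (forall s, unit_in s -> linear (m s)) -> forall s, linear (m s).
Proof.
move=> lin s a y z; apply/rowP => j; apply/eqP; rewrite -subr_eq0; apply/eqP.
pose f s := m s (a *: y + z) 0 j + - 1 * (a * m s y 0 j + m s z 0 j).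
have -> : m s (a *: y + z) 0 j - (a *: m s y + m s z) 0 j = f s.
  by rewrite /f mulN1r !mxE.
apply: (units_dense (f := f)) => [|{}s /lin lin_s]; last first.
  by rewrite /f lin_s mulN1r !mxE subrr.
have reg x : regular_fun (fun s : 'rV[K]_n => m s x 0 j).
  by have /regularP/(_ j) := mul_regular_l x.
by do ?[apply: regularD | apply: regularM | apply: regular_cst | apply: reg].
Qed.

Lemma units_linear_r :
  (forall s, unit_in s -> linear (fun x => m x s)) ->
  forall s, linear (fun x => m x s).
Proof.
move=> lin s a y z; apply/rowP => j; apply/eqP; rewrite -subr_eq0; apply/eqP.
pose f s := m (a *: y + z) s 0 j + - 1 * (a * m y s 0 j + m z s 0 j).
have -> : m (a *: y + z) s 0 j - (a *: m y s + m z s) 0 j = f s.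
  by rewrite /f mulN1r !mxE.
apply: (units_dense (f := f)) => [|{}s /lin lin_s]; last first.
  by rewrite /f lin_s mulN1r !mxE subrr.
have reg x : regular_fun (fun s : 'rV[K]_n => m x s 0 j).
  by have /regularP/(_ j) := mul_regular_r x.
by do ?[apply: regularD | apply: regularM | apply: regular_cst | apply: reg].
Qed.

End MonoidOnAffineSpace.

(** * The two-sided action of the unit group *)

Section Units.
Variable S : monoidType.
Local Open Scope group_scope.
Implicit Types g h : unit_group S.

Lemma lr_actionM (g h : unit_group S * unit_group S) s :
  lr_action (g * h) s = lr_action g (lr_action h s).
Proof.
by case: g h => [g1 g2] [h1 h2]; rewrite /lr_action /unit_val /= !mulgA.
Qed.

Lemma lr_action1 s : @lr_action S 1 s = s.
Proof. by rewrite /lr_action /unit_val /= mul1g mulg1. Qed.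

Lemma unit_of_inverses (a b : S) : a * b = 1 -> b * a = 1 ->
  exists g : unit_group S, unit_val g = a.
Proof.
move=> ab ba; have u : invertible_pair (a, b).
  by rewrite /invertible_pair /= ab ba eqxx.
by exists (UnitGroup u).
Qed.

Lemma lr_action_l g s : lr_action (g, 1) s = unit_val g * s.
Proof. by rewrite /lr_action /unit_val /= mulg1. Qed.

Lemma lr_action_r g s : lr_action (1, g^-1) s = s * unit_val g.
Proof. by rewrite /lr_action invgK /unit_val /= mul1g. Qed.

End Units.

(** * Linear coordinates on the variety of a vector space *)

Section Coordinates.
Variables (K : closedFieldType) (V : vectType K).

Lemma regular_v2r :
  regular (v2r : vect_variety V -> 'rV[K]_(dim V)).
Proof. by exists (fun j => 'X_j) => x j; rewrite mevalXU. Qed.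

Lemma regular_r2v :
  regular (r2v : 'rV[K]_(dim V) -> vect_variety V).
Proof.
exists (fun j => 'X_j) => x j; rewrite mevalXU.
by rewrite [coords _]r2vK.
Qed.

Lemma linear_coordinates n : dim V = n ->
  exists (c : vect_variety V -> 'rV[K]_n) (c' : 'rV[K]_n -> vect_variety V),
    [/\ biregular c c', linear (c : V -> _) & linear (c' : _ -> V)].
Proof.
case: _ /; exists v2r, r2v; split.
- split; [exact: regular_v2r | exact: regular_r2v | |].
    exact: v2rK.
  exact: r2vK.
- by move=> a x y; apply: linearP.
- by move=> a x y; apply: linearP.
Qed.

End Coordinates.

(** * The two implications *)

Section Main.
Variables (K : closedFieldType) (S : affineMonoidType K) (n : nat).
Hypothesis K0 : [pchar K] =i pred0.
Variables (phi : S -> 'rV[K]_n) (phi' : 'rV[K]_n -> S).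
Hypothesis phi_iso : biregular phi phi'.

Lemma biregular_comp (X Y Z : affineSetType K) (f : X -> Y) f' (g : Y -> Z) g' :
  biregular f f' -> biregular g g' -> biregular (g \o f) (f' \o g').
Proof.
move=> [fr f'r fK f'K] [gr g'r gK g'K].
by split; [exact: regular_comp fr gr | exact: regular_comp g'r f'r
          | exact: can_comp | exact: can_comp].
Qed.

Lemma linearizable_of_algebra (A : finDimAlgebra K) :
  isomorphic_to_mult_monoid S A ->
  linearizable (fun gh x => phi (lr_action gh (phi' x))).
Proof.
case: phi_iso => phi_reg phi'_reg phiK phi'K [f [g [fg_iso f1 fM]]].
have [v2r_reg r2v_reg] := (@regular_v2r K A, @regular_r2v K A).
have coord_iso : biregular (v2r : vect_variety A -> _)
    r2v.
  split=> //; first exact: v2rK.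
  exact: r2vK.
have phi'_iso : biregular phi' phi by [].
have dimA : dim A = n.
  by rewrite (biregular_dim
    (biregular_comp (biregular_comp phi'_iso fg_iso) coord_iso)).
have [c [c' [c_iso c_lin c'_lin]]] := linear_coordinates dimA.
have [_ _ fK gK] := fg_iso; have [_ _ cK c'K] := c_iso.
pose T gh x := c (f (lr_action gh (g (c' x)))).
have T_lin gh : linear (T gh).
  move=> a x y; rewrite /T /lr_action !fM !gK c'_lin alg_linear_r alg_linear_l.
  exact: c_lin.
have T1 x : T 1%g x = x by rewrite /T lr_action1 gK c'K.
have TM gh gh' x : T (gh * gh')%g x = T gh (T gh' x).
  by rewrite /T lr_actionM cK fK.
have T_mx gh : exists M, forall x, x *m M = T gh x.
  pose TL := GRing.isLinear.Build K _ _ _ (T gh) (T_lin gh).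
  exists (lin1_mx (HB.pack (T gh) TL : {linear 'rV[K]_n -> 'rV[K]_n})) => x.
  by rewrite mul_rV_lin1.
have mx_inj (M N : 'M[K]_n) : (forall x : 'rV_n, x *m M = x *m N) -> M = N.
  by move=> MN; apply/row_matrixP => i; rewrite !rowE MN.
(* The matrices of the action in the basis given by [c]. *)
pose H M := exists gh, forall x, x *m M = T gh x.
have H_inv M : H M -> exists2 N, H N & M *m N = 1%:M.
  case=> gh MT; have [N NT] := T_mx (gh^-1)%g.
  exists N; first by exists (gh^-1)%g.
  by apply: mx_inj => x; rewrite mulmxA MT NT -TM mulVg T1 mulmx1.
exists (c \o f \o phi'), (phi \o g \o c'); split.
  exact: biregular_comp (biregular_comp phi'_iso fg_iso) c_iso.
exists H; first split.
- by move=> M /H_inv[N _ /mulmx1_unit[]].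
- by exists 1%g => x; rewrite mulmx1 T1.
(* Matrices act on row vectors from the right, so products reverse. *)
- move=> M N [gh MT] [gh' NT]; exists (gh' * gh)%g => x.
  by rewrite mulmxA MT NT TM.
- move=> M /H_inv[N HN MN]; suff -> : invmx M = N by [].
  have [Mu _] := mulmx1_unit MN.
  by rewrite -[invmx M]mulmx1 -MN mulKmx.
have conjE gh : (c \o f \o phi') \o (fun x => phi (lr_action gh (phi' x)))
    \o (phi \o g \o c') =1 T gh.
  by move=> x; rewrite /= !phiK.
move=> F; split=> [[gh FE]|[M [gh MT] FE]].
  have [M MT] := T_mx gh; exists M; first by exists gh.
  by move=> x; rewrite FE -[LHS]/(_ x) conjE -MT.
by exists gh => x; rewrite FE conjE -MT.
Qed.

Lemma algebra_of_linearizable :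
  linearizable (fun gh x => phi (lr_action gh (phi' x))) ->
  exists A : finDimAlgebra K, isomorphic_to_mult_monoid S A.
Proof.
case=> psi [psi' [psi_iso [H _ HE]]].
have [] := biregular_comp phi_iso psi_iso.
set Phi := psi \o phi; set Phi' := phi' \o psi' => Phi_reg Phi'_reg PhiK Phi'K.
(* The product of [S] in the coordinates where the action is linear; the pairs [(g, 1)] and
   [(1, g^-1)] then give its one-sided translations. *)
pose m s x := Phi (Phi' s * Phi' x)%g; pose e := Phi 1%g.
have m_reg : regular (fun z : 'rV[K]_n * 'rV[K]_n => m z.1 z.2).
  have h1 := regular_comp (regular_fst 'rV[K]_n 'rV[K]_n) Phi'_reg.
  have h2 := regular_comp (regular_snd 'rV[K]_n 'rV[K]_n) Phi'_reg.
  exact: regular_comp (regular_comp (regular_pair h1 h2) mulg_regular) Phi_reg.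
have mA : associative m by move=> x y z; rewrite /m !PhiK mulgA.
have m1x : left_id e m by move=> x; rewrite /m /e PhiK mul1g Phi'K.
have mx1 : right_id e m by move=> x; rewrite /m /e PhiK mulg1 Phi'K.
have act_lin gh : linear (fun x => Phi (lr_action gh (Phi' x))).
  have [|M _ ME] := (HE (fun x => Phi (lr_action gh (Phi' x)))).1.
    by exists gh => x.
  by move=> a x y; rewrite !ME /= mulmxDl -scalemxAl.
have unit_lift s : unit_in m e s -> exists g : unit_group S, unit_val g = Phi' s.
  case=> t [st ts]; apply: (@unit_of_inverses _ _ (Phi' t));
    apply: (can_inj PhiK).
    exact: st.
  exact: ts.
have m_lin_r : forall s, linear (m s).
  apply: (units_linear_l K0 m_reg mA m1x mx1) => s /unit_lift[g gE] a x y.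
  by have := act_lin (g, 1%g) a x y; rewrite !lr_action_l gE.
have m_lin_l : forall s, linear (fun x => m x s).
  apply: (units_linear_r K0 m_reg mA m1x mx1) => s /unit_lift[g gE] a x y.
  by have := act_lin (1%g, g^-1%g) a x y; rewrite !lr_action_r gE.
pose A := @FinDimAlgebra K 'rV[K]_n m e mA m1x mx1 m_lin_l m_lin_r.
exists A, (Phi : S -> vect_variety A), (Phi' : vect_variety A -> S).
(* [vect_variety A] is coordinatized by [v2r], not by the identity of ['rV[K]_n]; these linear maps
   compare the two. *)
pose vA : 'rV[K]_n -> 'rV[K]_(dim A) := @v2r K A.
pose rA : 'rV[K]_(dim A) -> 'rV[K]_n := @r2v K A.
have vA_reg : regular vA by apply: regular_linear => a x y; apply: linearP.
have rA_reg : regular rA by apply: regular_linear => a x y; apply: linearP.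
split=> //; last by move=> x y; rewrite /= /m !PhiK.
split=> //.
  by have [F hF] := regular_comp Phi_reg vA_reg; exists F => x j; apply: hF.
have [F hF] := regular_comp (regular_comp (@regular_v2r K A) rA_reg) Phi'_reg.
by exists F => x j; rewrite -hF /= /rA v2rK.
Qed.

End Main.

Theorem proposition6 (K : closedFieldType) (char0 : [pchar K] =i pred0)
    (S : affineMonoidType K)
    (n : nat) (phi : S -> 'rV[K]_n) (phi' : 'rV[K]_n -> S)
    (phi_iso : biregular phi phi') :
  (exists A : finDimAlgebra K, isomorphic_to_mult_monoid S A) <->
  linearizable (fun gh x => phi (lr_action gh (phi' x))).
Proof.
split=> [[A]|]; first exact: linearizable_of_algebra.
exact: algebra_of_linearizable.
Qed.
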